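(* Let $U$ be an almost periodic unitary operator on a Hilbert space $\mathcal H$. Then for every $k\ge1$, every pair-partition $\alpha:\{1,\dots,2k\}\to\{1,\dots,k\}$ and all $A_1,\dots,A_{2k-1}\in\mathcal B(\mathcal H)$, $$\mathop{\mathrm{s\text{-}lim}}_{N\to\infty}\frac{1}{N^k}\sum_{n_1,\dots,n_k=0}^{N-1}U^{n_{\alpha(1)}}A_1U^{n_{\alpha(2)}}A_2\cdots U^{n_{\alpha(2k-1)}}A_{2k-1}U^{n_{\alpha(2k)}}=S_{\alpha;A_1,\dots,A_{2k-1}},$$ the limit being in the strong operator topology.
   Context: A unitary $U$ on $\mathcal H$ is almost periodic if $\mathcal H$ is the closed linear span of the eigenvectors of $U$. For $z\in\mathbb T$, $E_z$ is the orthogonal projection onto $\{x: Ux=zx\}$, $\sigma_{\mathrm{pp}}(U)$ is the set of eigenvalues of $U$, and $\sigma^{\mathrm a}_{\mathrm{pp}}(U):=\{z\in\sigma_{\mathrm{pp}}(U): zw=1 \text{ for some } w\in\sigma_{\mathrm{pp}}(U)\}$. A pair-partition $\alpha:\{1,\dots,2k\}\to\{1,\dots,k\}$ is a surjection each of whose fibres $\alpha^{-1}(\{j\})$ has exactly two elements. Given $z_1,\dots,z_k\in\mathbb T$, put $z^\#_{\alpha(i)}:=z_j$ if $i$ is the smaller element of $\alpha^{-1}(\{j\})$ and $z^\#_{\alpha(i)}:=\bar z_j$ if $i$ is the larger one (e.g. for $\alpha=(1,2,1,2)$ the term is $E_{z}A_1E_{w}A_2E_{\bar z}A_3E_{\bar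 w}$). The operator $S_{\alpha;A_1,\dots,A_{2k-1}}$ is the weak-operator limit (which exists) of the net, indexed by finite subsets $F\subset\sigma^{\mathrm a}_{\mathrm{pp}}(U)$ ordered by inclusion, of the operators $\sum_{z_1,\dots,z_k\in F}E_{z^\#_{\alpha(1)}}A_1E_{z^\#_{\alpha(2)}}A_2\cdots E_{z^\#_{\alpha(2k-1)}}A_{2k-1}E_{z^\#_{\alpha(2k)}}$. *)

(* Defs.v *)
From HB Require Import structures.
From mathcomp Require Import all_boot all_order all_algebra.
From mathcomp Require Import complex reals.
Set Implicit Arguments. Unset Strict Implicit. Unset Printing Implicit Defensive.
Import Order.TTheory GRing.Theory Num.Theory.
Local Open Scope ring_scope.
Local Open Scope complex_scope.

Section Hilbert.
Variables (R : realType) (H : lmodType R[i]) (ip : H -> H -> R[i]).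

Definition is_inner_product : Prop :=
  [/\ forall (a : R[i]) (x y z : H), ip (a *: x + y) z = a * ip x z + ip y z,
      forall x y : H, ip x y = (ip y x)^*,
      forall x : H, 0 <= ip x x
    & forall x : H, ip x x = 0 -> x = 0].

Definition hnorm (x : H) : R[i] := sqrtC (ip x x).

Definition seq_converges (u : nat -> H) (l : H) : Prop :=
  forall e : R, 0 < e -> exists N : nat, forall n : nat, (N <= n)%N ->
    hnorm (u n - l) < e%:C.

Definition is_cauchy (u : nat -> H) : Prop :=
  forall e : R, 0 < e -> exists N : nat, forall m n : nat, (N <= m)%N -> (N <= n)%N ->
    hnorm (u m - u n) < e%:C.

Definition is_hilbert : Prop :=
  is_inner_product /\
  forall u : nat -> H, is_cauchy u -> exists l : H, seq_converges u l.

Definition bounded_op (A : H -> H) : Prop :=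
  (forall (a : R[i]) (x y : H), A (a *: x + y) = a *: A x + A y) /\
  exists M : R, forall x : H, hnorm (A x) <= M%:C * hnorm x.

Definition unitary (U : H -> H) : Prop :=
  [/\ bounded_op U, forall x y : H, ip (U x) (U y) = ip x y
    & forall y : H, exists x : H, U x = y].

Definition eigenvector (U : H -> H) (x : H) : Prop :=
  x != 0 /\ exists z : R[i], U x = z *: x.

Definition eigenvalue (U : H -> H) (z : R[i]) : Prop :=
  exists x : H, x != 0 /\ U x = z *: x.

Definition in_span (P : H -> Prop) (y : H) : Prop :=
  exists s : seq (R[i] * H), (forall c, c \in s -> P c.2) /\
    y = \sum_(c <- s) c.1 *: c.2.

Definition almost_periodic (U : H -> H) : Prop :=
  forall (x : H) (e : R), 0 < e ->
    exists y : H, in_span (eigenvector U) y /\ hnorm (x - y) < e%:C.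

Definition is_orth_proj (V : H -> Prop) (P : H -> H) : Prop :=
  forall x : H, V (P x) /\ forall y : H, V y -> ip (x - P x) y = 0.

Definition eigenprojections (U : H -> H) (E : R[i] -> H -> H) : Prop :=
  forall z : R[i], is_orth_proj (fun x => U x = z *: x) (E z).

Definition sigma_a (U : H -> H) (z : R[i]) : Prop :=
  eigenvalue U z /\ exists w : R[i], eigenvalue U w /\ z * w = 1.

Definition chain (F A : nat -> H -> H) (m : nat) : H -> H :=
  foldr (fun i g => F i \o A i \o g) (F m) (iota 0 m).

End Hilbert.

Definition pair_partition (k : nat) (alpha : nat -> nat) : Prop :=
  (forall i : nat, (i < k.*2)%N -> (alpha i < k)%N) /\
  (forall j : nat, (j < k)%N -> count (fun i => alpha i == j) (iota 0 k.*2) = 2%N).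

(* z^#_{alpha(i)} : z_j if i is the smaller element of the fibre over j = alpha i,
   conj z_j if it is the larger one *)
Definition zsharp (R : realType) (k : nat) (alpha : nat -> nat) (z : nat -> R[i])
    (i : nat) : R[i] :=
  if has (fun i' => (alpha i' == alpha i) && (i' < i)%N) (iota 0 k.*2)
  then (z (alpha i))^* else z (alpha i).

Definition pick_tuple (R : realType) (k : nat) (F : seq R[i])
    (f : {ffun 'I_k -> 'I_(size F)}) (i : nat) : R[i] :=
  match @insub nat (fun i => (i < k)%N) 'I_k i with
  | Some i' => nth 0 F (f i')
  | None => 0
  end.

Definition S_net (R : realType) (H : lmodType R[i]) (E : R[i] -> H -> H)
    (k : nat) (alpha : nat -> nat) (A : nat -> H -> H) (F : seq R[i]) (x : H) : H :=
  \sum_(f : {ffun 'I_k -> 'I_(size F)})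
     chain (fun i => E (zsharp k alpha (pick_tuple f) i)) A (k.*2).-1 x.

Definition fin_subset_sigma_a (R : realType) (H : lmodType R[i]) (ip : H -> H -> R[i])
    (U : H -> H) (F : seq R[i]) : Prop :=
  uniq F /\ forall z, z \in F -> sigma_a U z.

(* S is the weak-operator limit of the net F |-> S_net F, indexed by finite subsets
   of sigma_pp^a(U) ordered by inclusion *)
Definition is_S (R : realType) (H : lmodType R[i]) (ip : H -> H -> R[i])
    (U : H -> H) (E : R[i] -> H -> H) (k : nat) (alpha : nat -> nat)
    (A : nat -> H -> H) (S : H -> H) : Prop :=
  forall (x y : H) (e : R), 0 < e ->
    exists F0 : seq R[i], fin_subset_sigma_a ip U F0 /\
      forall F : seq R[i], fin_subset_sigma_a ip U F -> {subset F0 <= F} ->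
        `| ip (S_net E k alpha A F x) y - ip (S x) y | < e%:C.

Definition cesaro (R : realType) (H : lmodType R[i]) (U : H -> H)
    (k : nat) (alpha : nat -> nat) (A : nat -> H -> H) (N : nat) (x : H) : H :=
  ((N ^ k)%:R)^-1 *:
  \sum_(n : {ffun 'I_k -> 'I_N})
     chain (fun i => iter (match @insub nat (fun i => (i < k)%N) 'I_k (alpha i) with
                           | Some j => val (n j) | None => 0%N end) U)
           A (k.*2).-1 x.

(* Main.v *)
(** Read each product from right to left.  At the first occurrence of a letter [j] the
    vector reached so far is approximated by a finite sum of eigenvectors, on which
    [U ^ n_j] acts as a scalar [v ^ n_j]; at the last occurrence of [j] the average over
    [n_j] of [v ^ n_j U ^ n_j] converges strongly, by the mean ergodic theorem, to the
    eigenprojection at [conj v].  All operators still to be applied on the left are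
    uniformly bounded, so the errors stay under control and the Cesaro means converge
    strongly.  The sums over finite sets [F] of eigenvalues obey the same recursion.
    Their norms are bounded uniformly in [F] because each of them is itself a limit of
    Cesaro means, in which the vector is compressed to the eigenspaces at [conj z],
    [z] in [F], at every first occurrence. *)
Require Import Defs.
From HB Require Import structures.
From mathcomp Require Import all_boot all_order all_algebra.
From mathcomp Require Import complex reals.
From mathcomp Require Import boolp classical_sets filter ring lra.
Import Order.TTheory GRing.Theory Num.Theory.
Local Open Scope ring_scope.
Set Implicit Arguments. Unset Strict Implicit. Unset Printing Implicit Defensive.

(** * Inner product, norm and the Cauchy-Schwarz inequality *)

Section InnerProduct.
Variables (R : realType) (H : lmodType R[i]) (ip : H -> H -> R[i]).
Hypothesis ip_inner : is_inner_product ip.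

Let ipC x y : ip x y = conjc (ip y x). Proof. by case: ip_inner. Qed.
Let ip_ge0 x : 0 <= ip x x. Proof. by case: ip_inner. Qed.
Let ip_eq0 x : ip x x = 0 -> x = 0. Proof. by case: ip_inner => _ _ _; apply. Qed.

Lemma ipDl x y z : ip (x + y) z = ip x z + ip y z.
Proof. by case: ip_inner => /(_ 1 x y z); rewrite scale1r mul1r. Qed.

Lemma ip0l z : ip 0 z = 0.
Proof. by apply: (addrI (ip 0 z)); rewrite -ipDl !addr0. Qed.

Lemma ipZl a x z : ip (a *: x) z = a * ip x z.
Proof. by case: ip_inner => /(_ a x 0 z); rewrite !addr0 ip0l addr0. Qed.

Lemma ipNl x z : ip (- x) z = - ip x z.
Proof. by rewrite -scaleN1r ipZl mulN1r. Qed.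

Lemma ipBl x y z : ip (x - y) z = ip x z - ip y z.
Proof. by rewrite ipDl ipNl. Qed.

Lemma ipDr x y z : ip x (y + z) = ip x y + ip x z.
Proof. by rewrite ipC ipDl rmorphD /= -!ipC. Qed.

Lemma ipZr a x z : ip x (a *: z) = conjc a * ip x z.
Proof. by rewrite ipC ipZl rmorphM /= -ipC. Qed.

Lemma ipBr x y z : ip x (y - z) = ip x y - ip x z.
Proof. by rewrite ipC ipBl rmorphB /= -!ipC. Qed.

Lemma ip_suml (I : Type) (s : seq I) (P : pred I) (f : I -> H) z :
  ip (\sum_(i <- s | P i) f i) z = \sum_(i <- s | P i) ip (f i) z.
Proof. by apply: (big_morph (ip^~ z)) => [x y|]; [exact: ipDl|exact: ip0l]. Qed.

Lemma ip_inj x y : (forall z, ip x z = ip y z) -> x = y.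
Proof.
by move=> xy; apply/eqP; rewrite -subr_eq0; apply/eqP/ip_eq0; rewrite ipBl xy subrr.
Qed.

(** [hnorm] is real but typed in [R[i]]; its real part lives in [R], where [lra] and [nra] apply. *)
Definition nrm (x : H) : R := complex.Re (hnorm ip x).

Lemma hnorm_ge0 x : 0 <= hnorm ip x.
Proof. by rewrite sqrtC_ge0. Qed.

Lemma hnormE x : hnorm ip x = (nrm x)%:C%C.
Proof. by rewrite /nrm RRe_real // ger0_real // hnorm_ge0. Qed.

Lemma eq_nrm x y : ip x x = ip y y -> nrm x = nrm y.
Proof. by rewrite /nrm /hnorm => ->. Qed.

Lemma nrm_ge0 x : 0 <= nrm x.
Proof. by rewrite -ler0c -hnormE hnorm_ge0. Qed.

Lemma ip_nrm x : ip x x = (nrm x ^+ 2)%:C%C.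
Proof. by rewrite rmorphXn /= -hnormE sqrtCK. Qed.

Lemma nrm0_eq0 x : nrm x = 0 -> x = 0.
Proof. by move=> x0; apply: ip_eq0; rewrite ip_nrm x0 expr0n. Qed.

Lemma nrm0 : nrm 0 = 0.
Proof.
apply/eqP; rewrite -sqrf_eq0 -(inj_eq (@complexI R)) -ip_nrm ip0l //.
Qed.

Lemma nrmZ a x : nrm (a *: x) = complex.Re `|a| * nrm x.
Proof.
have a0 : 0 <= complex.Re `|a| by rewrite -ler0c RRe_real ?ger0_real.
apply/eqP; rewrite -(eqrXn2 (n := 2)) ?nrm_ge0 ?mulr_ge0 ?nrm_ge0 //.
apply/eqP/complexI; rewrite -ip_nrm ipZl ipZr mulrA -sqr_normc exprMn rmorphM.
by rewrite /= -ip_nrm rmorphXn.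
Qed.

Lemma nrmZ1 a x : `|a| = 1 -> nrm (a *: x) = nrm x.
Proof. by move=> a1; rewrite nrmZ a1 mul1r. Qed.

Lemma nrmN x : nrm (- x) = nrm x.
Proof. by rewrite -scaleN1r nrmZ1 // normrN1. Qed.

Lemma nrmBC x y : nrm (x - y) = nrm (y - x).
Proof. by rewrite -nrmN opprB. Qed.

Lemma cauchy_schwarz x y : complex.Re `|ip x y| <= nrm x * nrm y.
Proof.
have [y0|yn0] := eqVneq (nrm y) 0.
  by rewrite (nrm0_eq0 y0) ipC ip0l conjc0 normr0 nrm0 mulr0.
(* [a *: y] is the projection of [x] onto the line of [y]; the inequality is the nonnegativity of
   the squared distance, multiplied by [ip y y]. *)
pose a := ip x y / ip y y.
have yy0 : ip y y != 0 by rewrite ip_nrm (inj_eq (@complexI R)) expf_eq0 /= (negPf yn0).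
have h := ip_ge0 (x - a *: y).
have E : ip (x - a *: y) (x - a *: y) * ip y y = ip x x * ip y y - `|ip x y| ^+ 2.
  have axy : a * ip y y = ip x y by rewrite divfK.
  rewrite ipBl !ipBr !ipZl !ipZr sqr_normc -ipC -axy; ring.
have : 0 <= ip x x * ip y y - `|ip x y| ^+ 2 by rewrite -E mulr_ge0.
rewrite subr_ge0 => k.
have a0 : 0 <= complex.Re `|ip x y| by rewrite -ler0c RRe_real ?ger0_real.
rewrite -(@ler_pXn2r _ 2) ?nnegrE ?mulr_ge0 ?nrm_ge0 // -lecR.
by rewrite rmorphXn exprMn [leRHS]rmorphM /= -!ip_nrm.
Qed.

Lemma nrmD x y : nrm (x + y) <= nrm x + nrm y.
Proof.
rewrite -(@ler_pXn2r _ 2) ?nnegrE ?addr_ge0 ?nrm_ge0 //.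
have -> : nrm (x + y) ^+ 2 = nrm x ^+ 2 + nrm y ^+ 2 + complex.Re (ip x y) *+ 2.
  apply: complexI; rewrite -ip_nrm ipDl !ipDr (ipC y x) rmorphD [X in _ = X + _]rmorphD.
  by rewrite [X in _ = _ + X]rmorphMn -[X in _ = _ + X]mulr_natl -addcJ /= -!ip_nrm; ring.
have : complex.Re (ip x y) <= nrm x * nrm y.
  apply: le_trans (cauchy_schwarz x y).
  rewrite normc_def /= (le_trans (ler_norm _)) // -sqrtr_sqr ler_wsqrtr //.
  by rewrite lerDl sqr_ge0.
nra.
Qed.

Lemma nrm_sum (I : Type) (s : seq I) (P : pred I) (f : I -> H) :
  nrm (\sum_(i <- s | P i) f i) <= \sum_(i <- s | P i) nrm (f i).
Proof.
elim/big_rec2: _ => [|i a b _ h]; first by rewrite nrm0.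
by apply: le_trans (nrmD _ _) _; rewrite lerD2l.
Qed.

Lemma nrm_dist x y z : nrm (x - z) <= nrm (x - y) + nrm (y - z).
Proof. by rewrite -[x in X in X <= _](subrK y) -addrA nrmD. Qed.

End InnerProduct.

(** * Elementary consequences of linearity *)

Section LinearMaps.
Variables (K : pzRingType) (V W : lmodType K) (A : V -> W).
Hypothesis linA : linear A.

Lemma linD x y : A (x + y) = A x + A y.
Proof. by have := linA 1 x y; rewrite !scale1r. Qed.

Lemma lin0 : A 0 = 0.
Proof. by apply: (addrI (A 0)); rewrite -linD !addr0. Qed.

Lemma linZ a x : A (a *: x) = a *: A x.
Proof. by have := linA a x 0; rewrite !addr0 lin0 addr0. Qed.

Lemma linB x y : A (x - y) = A x - A y.
Proof. by rewrite linD -scaleN1r linZ scaleN1r. Qed.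

Lemma lin_sum (I : Type) (s : seq I) (P : pred I) (f : I -> V) :
  A (\sum_(i <- s | P i) f i) = \sum_(i <- s | P i) A (f i).
Proof. by apply: (big_morph A) => [x y|]; [exact: linD|exact: lin0]. Qed.

End LinearMaps.

(** * Norm convergence along a filter *)

Section Convergence.
Variables (R : realType) (H : lmodType R[i]) (ip : H -> H -> R[i]).
Hypothesis ip_inner : is_inner_product ip.
Local Notation nrm := (nrm ip).
Local Open Scope classical_set_scope.

(** Filters treat sequences in [N] and nets of finite sets of eigenvalues uniformly. *)
Definition conv T (F : set_system T) (u : T -> H) (l : H) : Prop :=
  forall e : R, 0 < e -> F [set t | nrm (u t - l) < e].

Lemma seq_convergesE (u : nat -> H) l : seq_converges ip u l <-> conv \oo u l.
Proof.
split=> h e /h.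
- case=> N hN; exists N => // n /= Nn.
  by have := hN n Nn; rewrite (hnormE ip_inner) ltcR.
- case=> N _ hN; exists N => n Nn.
  by rewrite (hnormE ip_inner) ltcR; apply: hN.
Qed.

Section OneFilter.
Variables (T : Type) (F : set_system T).
Context {FF : Filter F}.

Lemma conv_cst l : conv F (fun=> l) l.
Proof. by move=> e e0; apply: filterS filterT => t _ /=; rewrite subrr (nrm0 ip_inner). Qed.

Lemma conv_near_eq u v l : F [set t | u t = v t] -> conv F v l -> conv F u l.
Proof. by move=> uv hv e e0; apply: filterS2 uv (hv e e0) => t /= ->. Qed.

Lemma conv_eq u v l : (forall t, u t = v t) -> conv F v l -> conv F u l.
Proof. by move=> uv; apply: conv_near_eq; apply: filterS filterT => t _. Qed.

Lemma convD u v l m : conv F u l -> conv F v m -> conv F (fun t => u t + v t) (l + m).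
Proof.
move=> hu hv e e0; have e2 : 0 < e / 2 by lra.
apply: filterS2 (hu _ e2) (hv _ e2) => t /= h1 h2.
rewrite opprD addrACA; have := nrmD ip_inner (u t - l) (v t - m); lra.
Qed.

Lemma conv_sum (I : eqType) (s : seq I) (u : I -> T -> H) (l : I -> H) :
  (forall i, i \in s -> conv F (u i) (l i)) ->
  conv F (fun t => \sum_(i <- s) u i t) (\sum_(i <- s) l i).
Proof.
elim: s => [|i s IH] h.
  by rewrite big_nil; apply: conv_eq (conv_cst 0) => t; rewrite big_nil.
rewrite big_cons.
apply: (@conv_eq _ (fun t => u i t + \sum_(i <- s) u i t)) => [t|].
  by rewrite big_cons.
apply: convD; first by apply: h; rewrite mem_head.
by apply: IH => j js; apply: h; rewrite inE js orbT.
Qed.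

Lemma conv_lip (u v : T -> H) l m (M : R) : 0 <= M ->
  F [set t | nrm (u t - l) <= M * nrm (v t - m)] -> conv F v m -> conv F u l.
Proof.
(* The [+ 1] keeps the divisor positive when [M = 0]. *)
move=> M0 uv hv e e0; have e1 : 0 < e / (M + 1) by apply: divr_gt0; lra.
apply: filterS2 uv (hv _ e1) => t /= h1.
rewrite ltr_pdivlMr => [h2|]; last by lra.
apply: le_lt_trans h1 (le_lt_trans _ h2).
by rewrite mulrDr mulr1 mulrC lerDl (nrm_ge0 ip_inner).
Qed.

Lemma convZ a u l : conv F u l -> conv F (fun t => a *: u t) (a *: l).
Proof.
apply: (@conv_lip _ _ _ _ (complex.Re `|a|)).
  by rewrite -ler0c RRe_real ?ger0_real.
by apply: filterS filterT => t _ /=; rewrite -scalerBr (nrmZ ip_inner).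
Qed.

End OneFilter.

Section ProperOneFilter.
Variables (T : Type) (F : set_system T).
Context {FF : ProperFilter F}.

Lemma conv_nrm_le u l v (C : R) : conv F u l ->
  F [set t | nrm (u t - v) <= C] -> nrm (l - v) <= C.
Proof.
move=> hu hC; rewrite leNgt; apply/negP => lt.
have e0 : 0 < nrm (l - v) - C by lra.
have [t /= [h1 h2]] := filter_ex (filterI (hu _ e0) hC).
have := nrm_dist ip_inner l (u t) v; rewrite (nrmBC ip_inner l (u t)); lra.
Qed.

Lemma conv_unique u l m : conv F u l -> conv F u m -> l = m.
Proof.
move=> hl hm; apply/eqP; rewrite -subr_eq0; apply/eqP/(nrm0_eq0 ip_inner)/eqP.
rewrite eq_le (nrm_ge0 ip_inner) andbT; apply/ler_addgt0Pl => e e0.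
rewrite addr0; apply: conv_nrm_le hl _.
by apply: filterS (hm _ e0) => t /= /ltW.
Qed.

End ProperOneFilter.

(** Common approximate limits make [u] a Cauchy sequence. Completeness gives its limit, which stays
    close to every approximate limit and is therefore also the limit of [v]. Completeness is thus
    used for sequences only. *)
Lemma conv_approx (T : Type) (F : set_system T) (FF : ProperFilter F)
    (u : nat -> H) (v : T -> H) : is_hilbert ip ->
  (forall e : R, 0 < e -> exists l, (\oo : set_system nat) [set n | nrm (u n - l) <= e]
     /\ F [set t | nrm (v t - l) <= e]) ->
  exists l, conv \oo u l /\ conv F v l.
Proof.
move=> [_ compl] h.
have [l /seq_convergesE hl] : exists l, seq_converges ip u l.
  apply: compl => e e0; have [|l [[N _ hN] _]] := h (e / 3); first by lra.
  exists N => m n Nm Nn; rewrite (hnormE ip_inner) ltcR.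
  have /= h1 := hN m Nm; have /= h2 := hN n Nn.
  by have := nrm_dist ip_inner (u m) l (u n); rewrite (nrmBC ip_inner l); lra.
exists l; split=> // e e0; have [|m [hu hv]] := h (e / 3); first by lra.
apply: filterS hv => t /= ht; have hlm : nrm (l - m) <= e / 3 by apply: conv_nrm_le hl hu.
by have := nrm_dist ip_inner (v t) m l; rewrite (nrmBC ip_inner m); lra.
Qed.

Lemma conv_div_nat (C e : R) : 0 < e ->
  (\oo : set_system nat) [set n : nat | C / n%:R < e].
Proof.
move=> e0; exists (Num.truncn (`|C| / e)).+1 => // n /= hn.
have n0 : 0 < n%:R :> R by rewrite ltr0n; apply: leq_trans hn.
rewrite ltr_pdivrMr //.
have : `|C| / e < n%:R.
  by apply: lt_le_trans (truncnS_gt _) _; rewrite ler_nat.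
rewrite ltr_pdivrMr // mulrC; apply: le_lt_trans; exact: ler_norm.
Qed.

End Convergence.

Lemma unit_conjcM (R : realType) (z : R[i]) : `|z| = 1 -> conjc z * z = 1.
Proof. by move=> z1; rewrite mulrC -sqr_normc z1 expr1n. Qed.

Lemma unit_mul_conjc_eq1 (R : realType) (v z : R[i]) :
  `|z| = 1 -> v * conjc z = 1 -> v = z.
Proof. by move=> /unit_conjcM z1 vz; rewrite -[v]mulr1 -z1 mulrA vz mul1r. Qed.

(** * Eigenprojections and the mean ergodic theorem *)

Section AlmostPeriodic.
Variables (R : realType) (H : lmodType R[i]) (ip : H -> H -> R[i]).
Variables (U : H -> H) (E : R[i] -> H -> H).
Hypotheses (ip_inner : is_inner_product ip) (U_unitary : unitary ip U).
Hypotheses (U_ap : almost_periodic ip U) (E_proj : eigenprojections ip U E).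
Local Notation nrm := (nrm ip).
Local Open Scope classical_set_scope.

(** Orthogonality gives [ip x p = ip p p], and Cauchy-Schwarz bounds the left side. *)
Lemma nrm_orth_le x p : ip (x - p) p = 0 -> nrm p <= nrm x.
Proof.
move=> xp; have [->|p0] := eqVneq (nrm p) 0; first exact: nrm_ge0.
have : nrm p ^+ 2 <= nrm x * nrm p.
  apply: le_trans (cauchy_schwarz ip_inner x p).
  have -> : ip x p = ip p p by apply/eqP; rewrite -subr_eq0 -(ipBl ip_inner) xp.
  by rewrite (ip_nrm ip_inner) normc_def /= expr0n addr0 sqrtr_sqr ler_norm.
by rewrite expr2 ler_pM2r // lt_neqAle eq_sym p0 (nrm_ge0 ip_inner).
Qed.

Lemma linU : linear U. Proof. by case: U_unitary => -[]. Qed.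

Lemma nrm_U x : nrm (U x) = nrm x.
Proof. by case: U_unitary => _ h _; apply: eq_nrm. Qed.

Lemma lin_iterU m : linear (iter m U).
Proof. by elim: m => // m IH a x y /=; rewrite IH linU. Qed.

Lemma nrm_iterU m x : nrm (iter m U x) = nrm x.
Proof. by elim: m => //= m IH; rewrite nrm_U. Qed.

Lemma iterU_eigen m v y : U y = v *: y -> iter m U y = v ^+ m *: y.
Proof.
move=> yv; elim: m => [|m IH] /=; first by rewrite scale1r.
by rewrite IH (linZ linU) yv scalerA exprSr.
Qed.

Lemma eigenvalue_norm v : Defs.eigenvalue U v -> `|v| = 1.
Proof.
case=> y [y0 yv]; have := nrm_U y; rewrite yv (nrmZ ip_inner) => h.
have yn0 : nrm y != 0 by apply: contraNneq y0 => /(nrm0_eq0 ip_inner) ->.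
rewrite -[LHS]RRe_real ?ger0_real //; congr (_ %:C)%C.
by apply: (mulIf yn0); rewrite h mul1r.
Qed.

(** Since [U] preserves [ip], the number [ip y u] equals [v * conjc z] times itself, and
    [v * conjc z = 1] would force [v = z]. *)
Lemma eigen_orth v z y u : U y = v *: y -> U u = z *: u -> v <> z -> ip y u = 0.
Proof.
move=> yv uz vz; have [->|u0] := eqVneq u 0.
  by case: ip_inner => _ -> _ _; rewrite (ip0l ip_inner) conjc0.
have z1 : `|z| = 1 by apply: eigenvalue_norm; exists u.
have : (v * conjc z - 1) * ip y u = 0.
  case: U_unitary => _ h _; rewrite mulrBl mul1r -{2}(h y u) yv uz.
  by rewrite (ipZl ip_inner) (ipZr ip_inner) mulrA subrr.
move/eqP; rewrite mulf_eq0 subr_eq0 => /orP[/eqP k|/eqP //].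
by case: vz; apply: unit_mul_conjc_eq1.
Qed.

Lemma E_eigen z x : U (E z x) = z *: E z x.
Proof. by have [] := E_proj z x. Qed.

Lemma ip_E z x y : U y = z *: y -> ip (E z x) y = ip x y.
Proof.
move=> yz; have [_ /(_ y yz) h] := E_proj z x.
by apply/eqP; rewrite eq_sym -subr_eq0 -(ipBl ip_inner) h.
Qed.

(** The difference of [E z x] and [p] lies in the eigenspace and is orthogonal to it. Linearity of
    [E z] and its values on eigenvectors follow from this. *)
Lemma E_unique z x p :
  U p = z *: p -> (forall y, U y = z *: y -> ip p y = ip x y) -> E z x = p.
Proof.
move=> pz h; apply/eqP; rewrite -subr_eq0; apply/eqP.
case: ip_inner => _ _ _; apply; rewrite (ipBl ip_inner) ip_E ?h ?subrr //.
  by rewrite (linB linU) E_eigen pz scalerBr.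
by rewrite (linB linU) E_eigen pz scalerBr.
Qed.

Lemma linE z : linear (E z).
Proof.
move=> a x y; apply: E_unique => [|u uz].
  by rewrite (linD linU) (linZ linU) !E_eigen scalerDr !scalerA mulrC.
by rewrite !(ipDl ip_inner) !(ipZl ip_inner) !ip_E.
Qed.

Lemma E_id z y : U y = z *: y -> E z y = y.
Proof. by move=> yz; apply: E_unique. Qed.

Lemma E_neq z v y : U y = v *: y -> v <> z -> E z y = 0.
Proof.
move=> yv vz; apply: E_unique => [|u uz]; first by rewrite scaler0 (lin0 linU).
by rewrite (ip0l ip_inner) (eigen_orth yv uz vz).
Qed.

Lemma E_not_eigenvalue z x : ~ Defs.eigenvalue U z -> E z x = 0.
Proof.
move=> nz; apply/eqP; apply: contra_notT nz => Ex0.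
by exists (E z x); rewrite E_eigen.
Qed.

Lemma nrm_E_le z x : nrm (E z x) <= nrm x.
Proof. by apply: nrm_orth_le; rewrite (ipBl ip_inner) ip_E ?subrr // E_eigen. Qed.

Definition Econj (F : seq R[i]) x := \sum_(z <- F) E (conjc z) x.

Lemma linEconj F : linear (Econj F).
Proof.
move=> a x y; rewrite /Econj scaler_sumr -big_split.
by apply: eq_bigr => z _; rewrite linE.
Qed.

(** Distinct eigenspaces are orthogonal, so for duplicate-free [F] the vector [Econj F x] is an
    orthogonal projection of [x]. *)
Lemma nrm_Econj_le F x : uniq F -> nrm (Econj F x) <= nrm x.
Proof.
move=> uF; apply: nrm_orth_le.
have h z : z \in F -> ip (Econj F x) (E (conjc z) x) = ip x (E (conjc z) x).
  move=> zF; rewrite (ip_suml ip_inner) (bigD1_seq z) //= big1 ?addr0 => [|w wz].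
    by rewrite ip_E // E_eigen.
  apply: eigen_orth (E_eigen _ _) (E_eigen _ _) _.
  by move/(can_inj (@conjcK _))/eqP; rewrite (negPf wz).
apply/eqP; rewrite -conjc_eq0; apply/eqP.
case: (ip_inner) => _ <- _ _; rewrite {1}/Econj (ip_suml ip_inner) big_seq.
rewrite big1 // => z zF; case: (ip_inner) => _ -> _ _.
by rewrite (ipBl ip_inner) h // subrr conjc0.
Qed.

(** Coefficients are absorbed into the eigenvectors. A vector [p.2] may then vanish, so that [p.1]
    is an eigenvalue is recorded separately. *)
Lemma eigen_approx x (e : R) : 0 < e ->
  exists t : seq (R[i] * H),
    (forall p, p \in t -> Defs.eigenvalue U p.1 /\ U p.2 = p.1 *: p.2) /\
    nrm (x - \sum_(p <- t) p.2) < e.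
Proof.
move=> e0; have [y [[s [hs ->]]]] := U_ap x e0.
rewrite (hnormE ip_inner) ltcR => hx.
suff [t ht ts] : exists2 t : seq (R[i] * H),
    forall p, p \in t -> Defs.eigenvalue U p.1 /\ U p.2 = p.1 *: p.2 &
    \sum_(p <- t) p.2 = \sum_(c <- s) c.1 *: c.2 by exists t; rewrite ts.
elim: s hs {hx} => [|c s IH] hs; first by exists [::]; rewrite ?big_nil.
have [d ds|t ht ts] := IH; first by apply: hs; rewrite inE ds orbT.
have [c0 [v cv]] := hs c (mem_head _ _).
exists ((v, c.1 *: c.2) :: t) => [p|]; last by rewrite !big_cons ts.
rewrite inE => /predU1P[->|/ht //] /=; split; first by exists c.2.
by rewrite (linZ linU) cv !scalerA mulrC.
Qed.

Definition erg (z : R[i]) (x : H) (N : nat) : H :=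
  N%:R^-1 *: \sum_(m < N) conjc z ^+ m *: iter m U x.

Lemma lin_erg z N : linear (erg z ^~ N).
Proof.
move=> a x y; rewrite /erg scalerA (mulrC a) -scalerA -scalerDr; congr (_ *: _).
rewrite scaler_sumr -big_split; apply: eq_bigr => m _.
by rewrite lin_iterU scalerDr !scalerA mulrC.
Qed.

Lemma nrm_erg_le z x N : `|z| = 1 -> nrm (erg z x N) <= nrm x.
Proof.
move=> z1; rewrite /erg (nrmZ ip_inner).
have -> : complex.Re `|N%:R^-1| = N%:R^-1 :> R.
  by rewrite ger0_norm ?invr_ge0 ?ler0n // -(rmorph_nat (real_complex R)) -fmorphV.
apply: le_trans (_ : N%:R^-1 * (N%:R * nrm x) <= _).
  rewrite ler_wpM2l ?invr_ge0 ?ler0n //; apply: le_trans (nrm_sum ip_inner _ _ _) _.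
  rewrite mulr_natl -[N in X in _ <= X]card_ord -sumr_const ler_sum // => m _.
  by rewrite (nrmZ1 ip_inner) ?nrm_iterU // normrX normcJ z1 expr1n.
rewrite mulrA; have [->|N0] := eqVneq N 0%N; first by rewrite mulr0 mul0r nrm_ge0.
by rewrite mulVf ?mul1r // pnatr_eq0.
Qed.

(** On an eigenvector [erg] is a scalar mean of powers of [q = conjc z * v]. It is 1 if [v = z] and
    [N > 0]; otherwise the geometric sum is at most [2 / |q - 1|], and division by [N] sends it to
    0. *)
Lemma erg_eigen z v y : `|z| = 1 -> `|v| = 1 -> U y = v *: y ->
  conv ip \oo (erg z y) (E z y).
Proof.
move=> z1 v1 yv.
have ergE N : erg z y N = (N%:R^-1 * \sum_(m < N) (conjc z * v) ^+ m) *: y.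
  rewrite /erg -scalerA scaler_suml; congr (_ *: _); apply: eq_bigr => m _.
  by rewrite (iterU_eigen _ yv) scalerA exprMn.
have [vz|/eqP vz] := eqVneq v z.
  have -> : E z y = y by apply: E_id; rewrite -vz.
  apply: conv_near_eq (conv_cst ip_inner y).
  exists 1%N => // N /= N0; rewrite ergE vz unit_conjcM //.
  under eq_bigr do rewrite expr1n; rewrite sumr_const card_ord mulVf ?scale1r //.
  by rewrite pnatr_eq0 -lt0n.
rewrite (E_neq yv vz); set q := conjc z * v in ergE.
have q1 : q - 1 != 0.
  rewrite subr_eq0; apply: contra_not_neq vz => q1.
  by apply: unit_mul_conjc_eq1 => //; rewrite mulrC.
have [r rE] : exists r : R, `|q - 1| = (r%:C)%C.
  by exists (complex.Re `|q - 1|); rewrite RRe_real ?ger0_real.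
move=> e e0; apply: filterS (conv_div_nat (2 / r * nrm y) e0) => N /=.
apply: le_lt_trans; rewrite subr0 ergE (nrmZ ip_inner) mulrAC.
rewrite ler_wpM2r ?nrm_ge0 // -lecR RRe_real ?ger0_real //.
have -> : ((2 / r / N%:R)%:C)%C = 2 / `|q - 1| / N%:R.
  by rewrite rE !rmorphM !fmorphV !rmorph_nat.
rewrite normrM mulrC normfV normr_nat.
rewrite ler_wpM2r ?invr_ge0 ?ler0n // ler_pdivlMr ?normr_gt0 // -normrM mulrC.
rewrite -subrX1; apply: le_trans (ler_normB _ _) _.
by rewrite normr1 normrX normrM normcJ z1 v1 mulr1 expr1n.
Qed.

(** [erg z] and [E z] are contractions, so the case of finite sums of eigenvectors extends by
    density. *)
Lemma mean_ergodic z x : `|z| = 1 -> conv ip \oo (erg z x) (E z x).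
Proof.
move=> z1 e e0; have [|t [ht hx]] := @eigen_approx x (e / 3); first by lra.
have : conv ip \oo (fun N => \sum_(p <- t) erg z p.2 N) (\sum_(p <- t) E z p.2).
  apply: conv_sum => // p /ht [pv hp].
  by apply: erg_eigen hp => //; apply: eigenvalue_norm.
move/(_ (e / 3)) => h; apply: filterS (h _) => [N /=|]; last by lra.
rewrite -(lin_sum (lin_erg z N)) -(lin_sum (linE z)); set y := \sum_(p <- t) _ => hN.
have := nrm_dist ip_inner (erg z x N) (erg z y N) (E z x).
have := nrm_dist ip_inner (erg z y N) (E z y) (E z x).
rewrite -(linB (lin_erg z N)) -(linB (linE z)).
have := nrm_erg_le (x - y) N z1; have := nrm_E_le z (y - x).
rewrite (nrmBC ip_inner y x); rewrite -/y in hx; lra.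
Qed.

End AlmostPeriodic.

(** * Reassigning the value of one letter *)

Section Update.
Variable T : Type.
Implicit Types (w : nat -> T) (z : T).

Definition upd w j z := fun i => if i == j then z else w i.

Lemma upd_eq w j z : upd w j z j = z.
Proof. by rewrite /upd eqxx. Qed.

Lemma upd_neq w j z i : i != j -> upd w j z i = w i.
Proof. by rewrite /upd => /negPf ->. Qed.

Lemma upd_comm w i j y z : i != j -> upd (upd w j z) i y = upd (upd w i y) j z.
Proof.
move=> ij; apply/funext => l; rewrite /upd.
by case: (eqVneq l i) => // ->; rewrite (negPf ij).
Qed.

End Update.

(** * Averages over all exponents *)

Section Average.
Variables (R : realType) (H : lmodType R[i]) (ip : H -> H -> R[i]) (k : nat).
Hypothesis ip_inner : is_inner_product ip.
Local Notation nrm := (nrm ip).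

(** Repeats the [match] of [cesaro], turning tuples of exponents into functions on [nat]. *)
Definition env N (n : {ffun 'I_k -> 'I_N}) (i : nat) : nat :=
  match @insub nat (fun i => (i < k)%N) 'I_k i with
  | Some j => val (n j) | None => 0%N end.

Definition avg N (g : (nat -> nat) -> H) : H :=
  ((N ^ k)%:R)^-1 *: \sum_(n : {ffun 'I_k -> 'I_N}) g (env n).

Lemma avg_le N g (M : R) : 0 <= M -> (forall n, nrm (g n) <= M) -> nrm (avg N g) <= M.
Proof.
move=> M0 gM; rewrite /avg (nrmZ ip_inner).
have -> : complex.Re `|(N ^ k)%:R^-1| = (N ^ k)%:R^-1 :> R.
  by rewrite ger0_norm ?invr_ge0 ?ler0n // -(rmorph_nat (real_complex R)) -fmorphV.
apply: le_trans (_ : (N ^ k)%:R^-1 * ((N ^ k)%:R * M) <= _).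
  rewrite ler_wpM2l ?invr_ge0 ?ler0n //; apply: le_trans (nrm_sum ip_inner _ _ _) _.
  have <- : #|{ffun 'I_k -> 'I_N}| = (N ^ k)%N by rewrite card_ffun !card_ord.
  by rewrite mulr_natl -sumr_const ler_sum.
rewrite mulrA; have [->|N0] := eqVneq (N ^ k)%N 0%N; first by rewrite mulr0 mul0r.
by rewrite mulVf ?mul1r // pnatr_eq0.
Qed.

Lemma avg_sum N (I : Type) (s : seq I) (g : I -> (nat -> nat) -> H) :
  avg N (fun n => \sum_(i <- s) g i n) = \sum_(i <- s) avg N (g i).
Proof. by rewrite /avg exchange_big scaler_sumr. Qed.

Lemma eq_avg N g h : (forall n, g n = h n) -> avg N g = avg N h.
Proof. by move=> gh; rewrite /avg; under eq_bigr do rewrite gh. Qed.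

Lemma lin_avg N (g : (nat -> nat) -> H -> H) : (forall n, linear (g n)) ->
  linear (fun x => avg N (g^~ x)).
Proof.
move=> gl a x y; rewrite /avg scalerA (mulrC a) -scalerA -scalerDr; congr (_ *: _).
by rewrite scaler_sumr -big_split; apply: eq_bigr => n _; rewrite gl.
Qed.

(** One coordinate can be averaged separately first; [N > 0] is needed to cancel [N] against its
    inverse. *)
Lemma avg_resample N j g : (j < k)%N -> (0 < N)%N ->
  avg N g = avg N (fun n => N%:R^-1 *: \sum_(m < N) g (upd n j m)).
Proof.
move=> jk N0; rewrite /avg; congr (_ *: _); rewrite -scaler_sumr.
pose o := Ordinal jk.
pose put (n : {ffun 'I_k -> 'I_N}) m := [ffun i => if i == o then m else n i].
have envE n (m : 'I_N) : upd (env n) j m = env (put n m).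
  apply/funext => i; rewrite /upd /env; case: insubP => [i' ik <-|].
    by rewrite ffunE -(inj_eq val_inj) /=; case: eqP.
  by case: eqP => [->|]; rewrite ?jk.
(* Exchanging the coordinate at [j] with the extra index is an involution; after reindexing, the
   extra index no longer enters [g]. *)
pose h (p : {ffun 'I_k -> 'I_N} * 'I_N) := (put p.1 p.2, p.1 o).
have hK : involutive h.
  case=> n m; rewrite /h /= ffunE eqxx; congr (_, _).
  by apply/ffunP => i; rewrite !ffunE; case: eqP => [->|].
rewrite pair_bigA (reindex_inj (inv_inj hK)) /=.
rewrite (eq_bigr (fun p => g (env p.1))) => [|[n m] _]; last first.
  rewrite /= envE; congr (g (env _)).
  by apply/ffunP => i; rewrite !ffunE; case: eqP => [->|].
rewrite -(pair_bigA _ (fun n _ => g (env n))) /= scaler_sumr.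
apply: eq_bigr => n _; rewrite sumr_const card_ord -scalerMnr scalerMnl.
by rewrite -[X in X *: _]mulr_natl mulfV ?scale1r // pnatr_eq0 -lt0n.
Qed.

End Average.

(** * Words, their Cesaro means and their eigenvalue sums *)

Section Words.
Variables (R : realType) (H : lmodType R[i]) (ip : H -> H -> R[i]).
Variables (U : H -> H) (E : R[i] -> H -> H) (k : nat).
Hypotheses (ip_hilbert : is_hilbert ip) (U_unitary : unitary ip U).
Hypotheses (U_ap : almost_periodic ip U) (E_proj : eigenprojections ip U E).
Local Notation nrm := (nrm ip).
Local Notation word := (seq (nat * (H -> H))).
Local Open Scope classical_set_scope.
Implicit Types (s : word) (w : nat -> R[i]) (Q : H -> H) (F : seq R[i]).

Let ip_inner : is_inner_product ip. Proof. by case: ip_hilbert. Qed.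
Let linU := linU U_unitary.
Let linE := linE ip_inner U_unitary E_proj.

(* A word lists the pairs (alpha(i), A_i) in the order in which they act on a
   vector.  At the first occurrence of a letter [j] the contraction [Q] is
   applied before [U ^ n_j]; the eigenvalue [conjc (w j)] which that occurrence
   has produced is accounted for only at the last occurrence. *)
Fixpoint uword Q s w (n : nat -> nat) x : H :=
  match s with
  | [::] => x
  | (j, B) :: s' =>
    if j \in unzip1 s' then uword Q s' (upd w j 1) n (iter (n j) U (Q (B x)))
    else uword Q s' w n (conjc (w j) ^+ n j *: iter (n j) U (B x))
  end.

(** Words act from right to left, so the first occurrence met is the larger index of its pair and
    carries the conjugate; the last occurrence uses the stored value [w j]. *)
Fixpoint esum F s w x : H :=
  match s with
  | [::] => x
  | (j, B) :: s' =>
    if j \in unzip1 s' then \sum_(z <- F) esum F s' (upd w j z) (E (conjc z) (B x))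
    else esum F s' w (E (w j) (B x))
  end.

(** Letters occur at most twice rather than exactly twice, so that the condition passes to the tails
    met in inductions. *)
Fixpoint wf s : Prop :=
  match s with
  | [::] => True
  | (j, B) :: s' =>
    [/\ (j < k)%N, bounded_op ip B, (count_mem j (unzip1 s') <= 1)%N & wf s']
  end.

Let count1 j (t : seq nat) : j \in t -> (count_mem j t <= 1)%N -> count_mem j t = 1%N.
Proof. by rewrite -has_pred1 has_count => h1 h2; apply/eqP; rewrite eqn_leq h1 h2. Qed.

Lemma lin_uword Q s w n : linear Q -> wf s -> linear (uword Q s w n).
Proof.
move=> lQ; elim: s w => [|[j B] s IH] w //= [_ [lB _] _ ws] a x y.
case: ifP => _; rewrite lB ?lQ (lin_iterU U_unitary) ?IH //.
by rewrite scalerDr scalerA (mulrC _ a) -scalerA IH.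
Qed.

Lemma uword_upd_env Q s w n j m x : j \notin unzip1 s ->
  uword Q s w (upd n j m) x = uword Q s w n x.
Proof.
elim: s w x => [|[i B] s IH] w x //=; rewrite inE negb_or => /andP[ij js].
by rewrite upd_neq 1?eq_sym //; case: ifP => _; rewrite IH.
Qed.

Lemma uword_upd Q s w n j z x : j \notin unzip1 s ->
  uword Q s (upd w j z) n x = uword Q s w n x.
Proof.
elim: s w x => [|[i B] s IH] w x //=; rewrite inE negb_or => /andP[ij js].
case: ifP => _; first by rewrite upd_comm 1?eq_sym // IH.
by rewrite upd_neq 1?eq_sym // IH.
Qed.

(** The scalar slides through the linear maps to the only remaining occurrence of [j], where the
    weight [conjc (w j) ^+ n j] with [w j = conjc v] accounts for it. *)
Lemma uword_weight Q s w n j v x : linear Q -> wf s -> count_mem j (unzip1 s) = 1%N ->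
  uword Q s (upd w j 1) n (v ^+ n j *: x) = uword Q s (upd w j (conjc v)) n x.
Proof.
move=> lQ; elim: s w x => [|[i B] s IH] w x //= [_ [lB _] _ ws].
have [->|ij] := eqVneq i j.
  move=> [/eqP]; rewrite -leqn0 leqNgt -has_count has_pred1 => js.
  rewrite (negPf js) !upd_eq !(uword_upd _ _ _ _ _ js) conjcK conjc1 expr1n.
  by rewrite scale1r (linZ lB) (linZ (lin_iterU U_unitary _)).
rewrite add0n => js; case: ifP => _.
  rewrite !(upd_comm _ _ _ ij) -IH //.
  by rewrite (linZ lB) (linZ lQ) (linZ (lin_iterU U_unitary _)).
rewrite !upd_neq // -IH // (linZ lB) (linZ (lin_iterU U_unitary _)).
by rewrite !scalerA mulrC.
Qed.

(** Powers of [U] are isometric, the weights have modulus one and [Q] is a contraction, so only the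
    bounds of the operators [B] enter and [M] is uniform in [Q], [w] and [n]. *)
Lemma uword_bound s : wf s -> exists2 M : R, 0 <= M & forall Q w n x,
  (forall y, nrm (Q y) <= nrm y) -> (forall j, `|w j| = 1) ->
  nrm (uword Q s w n x) <= M * nrm x.
Proof.
elim: s => [|[j B] s IH] /=; first by exists 1 => // *; rewrite mul1r.
(* [b] can be negative when the space is zero, hence the maximum. *)
move=> [_ [_ [b hb]] _ /IH [M M0 hM]]; exists (M * Num.max b 0).
  by rewrite mulr_ge0 // le_max lexx orbT.
have {}hb x : nrm (B x) <= Num.max b 0 * nrm x.
  have := hb x; rewrite !(hnormE ip_inner) -rmorphM lecR => /le_trans; apply.
  by rewrite ler_wpM2r ?nrm_ge0 // le_max lexx.
move=> Q w n x hQ hw; rewrite -mulrA; case: ifP => _.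
  apply: le_trans (hM _ _ _ _ hQ _) _ => [i|].
    by rewrite /upd; case: eqP; rewrite ?normr1.
  by rewrite ler_wpM2l // (nrm_iterU U_unitary) (le_trans (hQ _)).
apply: le_trans (hM _ _ _ _ hQ hw) _; rewrite ler_wpM2l //.
rewrite (nrmZ1 ip_inner) ?(nrm_iterU U_unitary) //.
by rewrite normrX normcJ hw expr1n.
Qed.

Definition mean Q s w N x := avg k N (fun n => uword Q s w n x).

Lemma lin_mean Q s w N : linear Q -> wf s -> linear (mean Q s w N).
Proof. by move=> lQ ws; apply: lin_avg => n; apply: lin_uword. Qed.

Lemma mean_bound s : wf s -> exists2 M : R, 0 <= M & forall Q w N x,
  (forall y, nrm (Q y) <= nrm y) -> (forall j, `|w j| = 1) ->
  nrm (mean Q s w N x) <= M * nrm x.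
Proof.
move=> /uword_bound [M M0 hM]; exists M => // Q w N x hQ hw.
by apply: avg_le => // [|n]; rewrite ?mulr_ge0 ?nrm_ge0 ?hM.
Qed.

Lemma mean_first Q s w N j B x (t : seq (R[i] * H)) :
  linear Q -> wf ((j, B) :: s) -> j \in unzip1 s ->
  (forall p, p \in t -> U p.2 = p.1 *: p.2) -> Q (B x) = \sum_(p <- t) p.2 ->
  mean Q ((j, B) :: s) w N x = \sum_(p <- t) mean Q s (upd w j (conjc p.1)) N p.2.
Proof.
move=> lQ /= [_ _ js1 ws] js ht QBx; rewrite /mean -avg_sum; apply: eq_avg => n.
rewrite /= js QBx (lin_sum (lin_iterU U_unitary _)) (lin_sum (lin_uword _ _ lQ ws)).
apply: eq_big_seq => p /ht pU.
by rewrite (iterU_eigen U_unitary _ pU) uword_weight // count1.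
Qed.

(** The exponent [n j] does not enter the tail, so averaging over it first produces [erg]. *)
Lemma mean_last Q s w N j B x : linear Q -> wf ((j, B) :: s) -> j \notin unzip1 s ->
  (0 < N)%N -> mean Q ((j, B) :: s) w N x = mean Q s w N (erg U (w j) (B x) N).
Proof.
move=> lQ /= [jk _ _ ws] js N0; rewrite /mean (avg_resample _ jk N0).
apply: eq_avg => n; rewrite /= (negPf js) /erg (linZ (lin_uword _ _ lQ ws)).
rewrite (lin_sum (lin_uword _ _ lQ ws)); congr (_ *: _).
by apply: eq_bigr => m _; rewrite uword_upd_env // upd_eq.
Qed.

(** The error [d N] tends to 0 by the mean ergodic theorem, and the means of the tail are bounded
    uniformly in [N]. *)
Lemma mean_last_conv Q s w j B x l : linear Q -> (forall y, nrm (Q y) <= nrm y) ->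
  (forall i, `|w i| = 1) -> wf ((j, B) :: s) -> j \notin unzip1 s ->
  conv ip \oo (fun N => mean Q s w N (E (w j) (B x))) l ->
  conv ip \oo (fun N => mean Q ((j, B) :: s) w N x) l.
Proof.
move=> lQ hQ hw ws js hl; have [_ _ _ ws'] := ws.
have [M M0 hM] := mean_bound ws'.
pose d N := erg U (w j) (B x) N - E (w j) (B x).
apply: (@conv_near_eq _ _ _ _ _ _ _
  (fun N => mean Q s w N (d N) + mean Q s w N (E (w j) (B x)))).
  by exists 1%N => // N /= N0; rewrite mean_last // -(linD (lin_mean _ _ lQ ws')) subrK.
rewrite -[l]add0r; apply: convD => //.
apply: (@conv_lip _ _ _ ip_inner _ _ _ _ (erg U (w j) (B x)) _ (E (w j) (B x)) M) => //.
  by apply: filterS filterT => N _ /=; rewrite subr0 hM.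
exact: (mean_ergodic ip_inner U_unitary U_ap E_proj).
Qed.

Lemma lin_esum F s w : wf s -> linear (esum F s w).
Proof.
elim: s w => [|[j B] s IH] w //= [_ [lB _] _ ws] a x y; rewrite lB.
case: ifP => _; last by rewrite linE IH.
rewrite scaler_sumr -big_split; apply: eq_bigr => z _.
by rewrite linE IH.
Qed.

(** The last occurrence of [j] applies [E z], which is zero. *)
Lemma esum_vanish F s w j z x : wf s -> count_mem j (unzip1 s) = 1%N ->
  ~ Defs.eigenvalue U z -> esum F s (upd w j z) x = 0.
Proof.
move=> + + nz; elim: s w x => [|[i B] s IH] w x //= [_ _ _ ws].
have [->|ij] := eqVneq i j.
  move=> [/eqP]; rewrite -leqn0 leqNgt -has_count has_pred1 => js.
  by rewrite (negPf js) upd_eq (E_not_eigenvalue E_proj) // (lin0 (lin_esum _ _ ws)).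
rewrite add0n => js; case: ifP => _; last by rewrite IH.
by rewrite big1 // => y _; rewrite upd_comm // IH.
Qed.

Let finset_norm F z : fin_subset_sigma_a ip U F -> z \in F -> `|z| = 1.
Proof. by move=> [_ hF] /hF [/(eigenvalue_norm ip_inner U_unitary)]. Qed.

Lemma esum_mean F s w x : fin_subset_sigma_a ip U F -> wf s -> (forall j, `|w j| = 1) ->
  conv ip \oo (fun N => mean (Econj E F) s w N x) (esum F s w x).
Proof.
move=> hF; have uF : uniq F by case: hF.
have lQ := linEconj ip_inner U_unitary E_proj F.
elim: s w x => [|[j B] s IH] w x ws hw.
  have k0 N : (0 < N)%N -> mean (Econj E F) [::] w N x = x.
    move=> N0; rewrite /mean /avg sumr_const card_ffun !card_ord -scalerMnr scalerMnl.
    by rewrite -[X in X *: _]mulr_natl mulfV ?scale1r // pnatr_eq0 expn_eq0 negb_and -lt0n N0.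
  by apply: conv_near_eq (conv_cst ip_inner x); exists 1%N => // N /= /k0.
have [_ _ _ ws'] := ws; have [js|js] := boolP (j \in unzip1 s); last first.
  rewrite /= (negPf js); apply: mean_last_conv (IH _ _ ws' hw) => // y.
  exact: (nrm_Econj_le ip_inner U_unitary E_proj).
rewrite /= js.
apply: (@conv_eq _ _ _ _ _ _ _
  (fun N => \sum_(z <- F) mean (Econj E F) s (upd w j z) N (E (conjc z) (B x)))).
  move=> N; rewrite (@mean_first _ _ _ _ _ _ _
    [seq (conjc z, E (conjc z) (B x)) | z <- F]) // ?big_map //.
    by apply: eq_bigr => z _; rewrite conjcK.
  by move=> _ /mapP[z _ ->] /=; rewrite (E_eigen E_proj).
apply: conv_sum => // z zF; apply: IH => // i; rewrite /upd.
by case: eqP => // _; apply: finset_norm zF.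
Qed.

(** A termwise estimate would grow with [F]. The bound on means is uniform over all contractions
    [Q], hence over [F], and passes to the limit. *)
Lemma esum_bound s : wf s -> exists2 M : R, 0 <= M & forall F w x,
  fin_subset_sigma_a ip U F -> (forall j, `|w j| = 1) ->
  nrm (esum F s w x) <= M * nrm x.
Proof.
move=> ws; have [M M0 hM] := mean_bound ws; exists M => // F w x hF hw.
rewrite -[esum F s w x]subr0; apply: conv_nrm_le (esum_mean _ hF ws hw) _ => //.
apply: filterS filterT => N _ /=; rewrite subr0 hM // => y.
by apply: (nrm_Econj_le ip_inner U_unitary E_proj); case: hF.
Qed.

(** The filter of tails of the net, so that [conv ip finsets] is convergence of the net. *)
Definition finsets : set_system (seq R[i]) :=
  filter_from (fin_subset_sigma_a ip U)
    (fun F0 => [set F | fin_subset_sigma_a ip U F /\ {subset F0 <= F}]).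

Lemma finset_cup F G : fin_subset_sigma_a ip U F -> fin_subset_sigma_a ip U G ->
  fin_subset_sigma_a ip U (undup (F ++ G)).
Proof.
move=> [_ hF] [_ hG]; split; first exact: undup_uniq.
by move=> z; rewrite mem_undup mem_cat => /orP[/hF|/hG].
Qed.

#[local] Instance finsets_filter : ProperFilter finsets.
Proof.
apply: filter_from_proper => [|F hF]; last by exists F; split.
apply: filter_from_filter => [|F G hF hG]; first by exists [::].
exists (undup (F ++ G)) => [|K /= [hK FG]]; first exact: finset_cup.
by split; split=> // z zF; apply: FG; rewrite mem_undup mem_cat zF ?orbT.
Qed.

Lemma esum_first F s w j (t : seq (R[i] * H)) : uniq F ->
  wf ((j, idfun) :: s) -> j \in unzip1 s ->
  (forall p, p \in t -> U p.2 = p.1 *: p.2) ->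
  (forall p, p \in t -> Defs.eigenvalue U (conjc p.1) -> conjc p.1 \in F) ->
  esum F ((j, idfun) :: s) w (\sum_(p <- t) p.2) =
  \sum_(p <- t) esum F s (upd w j (conjc p.1)) p.2.
Proof.
move=> uF /= [_ _ js1 ws] js ht tF; rewrite js.
under eq_bigr do rewrite (lin_sum (linE _)) (lin_sum (lin_esum _ _ ws)).
rewrite exchange_big; apply: eq_big_seq => p pt /=.
have E0 z : conjc z <> p.1 -> E (conjc z) p.2 = 0.
  move=> zp; apply: (E_neq ip_inner U_unitary E_proj (ht p pt)) => pz.
  exact: zp.
(* If [conjc p.1] lies in [F], only [z = conjc p.1] contributes. Otherwise the left side vanishes by
   orthogonality, and the right side because [conjc p.1] is not an eigenvalue. *)
have [pF|pF] := boolP (conjc p.1 \in F).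
  rewrite (bigD1_seq _ pF) //= conjcK.
  rewrite (E_id ip_inner U_unitary E_proj (ht p pt)) big1 ?addr0 // => z zp.
  rewrite E0 ?(lin0 (lin_esum _ _ ws)) // => pz.
  by rewrite -pz conjcK eqxx in zp.
rewrite big1_seq => [|z /= zF].
  have nv : ~ Defs.eigenvalue U (conjc p.1) by move/(tF p pt); rewrite (negPf pF).
  by rewrite (esum_vanish _ _ _ ws (count1 js js1) nv).
rewrite E0 ?(lin0 (lin_esum _ _ ws)) // => pz.
by rewrite -pz conjcK zF in pF.
Qed.

Lemma id_bounded : bounded_op ip idfun.
Proof. by split=> //; exists 1 => x; rewrite mul1r. Qed.

Lemma mean_esum_conv s w x : wf s -> (forall j, `|w j| = 1) ->
  exists l, conv ip \oo (fun N => mean idfun s w N x) l /\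
            conv ip finsets (fun F => esum F s w x) l.
Proof.
elim: s w x => [|[j B] s IH] w x ws hw.
  exists x; split; last exact: conv_cst.
  (* The empty word ignores [Q], so [esum_mean] for the empty set gives the limit of the means. *)
  have hF : fin_subset_sigma_a ip U [::] by split.
  by apply: conv_eq (@esum_mean [::] [::] w x hF I hw).
have [jk bB js1 ws'] := ws; have [js|js] := boolP (j \in unzip1 s); last first.
  have [l [h1 h2]] := IH w (E (w j) (B x)) ws' hw; exists l; split.
    exact: mean_last_conv h1.
  by rewrite /= (negPf js).
(* With [idfun] in place of [B], the word can be evaluated both at [B x] and at its approximation
   [y]. *)
have wid : wf ((j, idfun) :: s) by split=> //; apply: id_bounded.
have [M M0 hM] := mean_bound wid; have [M' M'0 hM'] := esum_bound wid.
apply: conv_approx => // e e0.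
(* Chosen so that replacing [B x] by [y] costs at most [e / 2] in the means and in the sums
   alike. *)
pose d := e / 2 / (M + M' + 1).
have d0 : 0 < d by apply: divr_gt0; lra.
have Md : M * d <= e / 2 /\ M' * d <= e / 2.
  have : d * (M + M' + 1) = e / 2 by rewrite divfK // gt_eqF //; lra.
  by split; nra.
have [t [ht hx]] := eigen_approx ip_inner U_unitary U_ap (B x) d0.
have htU p : p \in t -> U p.2 = p.1 *: p.2 by move=> /ht[].
set y := \sum_(p <- t) p.2 in hx.
(* For the finite sum [y], the induction hypothesis gives a common limit term by term. *)
have [l [hl1 hl2]] : exists l,
    conv ip \oo (fun N => \sum_(p <- t) mean idfun s (upd w j (conjc p.1)) N p.2) l /\
    conv ip finsets (fun F => \sum_(p <- t) esum F s (upd w j (conjc p.1)) p.2) l.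
  elim: t ht {hx htU y} => [|p t IHt] ht.
    by exists 0; split; apply: conv_eq (conv_cst ip_inner 0) => ?; rewrite big_nil.
  have [q qt|l [h1 h2]] := IHt; first by apply: ht; rewrite inE qt orbT.
  have [|l' [h1' h2']] := IH (upd w j (conjc p.1)) p.2 ws'.
    have [pv _] := ht p (mem_head _ _).
    move=> i; rewrite /upd; case: eqP => // _.
    by rewrite normcJ (eigenvalue_norm ip_inner U_unitary pv).
  exists (l' + l); split.
    by apply: conv_eq (convD ip_inner h1' h1) => ?; rewrite big_cons.
  by apply: conv_eq (convD ip_inner h2' h2) => ?; rewrite big_cons.
have e2 : 0 < e / 2 by lra.
exists l; split.
  apply: filterS (hl1 _ e2) => N /=.
  rewrite -(@mean_first idfun s w N j idfun y t) // => h.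
  have hd : nrm (mean idfun ((j, B) :: s) w N x - mean idfun ((j, idfun) :: s) w N y)
      <= M * d.
    have -> : mean idfun ((j, B) :: s) w N x = mean idfun ((j, idfun) :: s) w N (B x).
      by [].
    rewrite -(linB (lin_mean _ _ _ wid)) //; apply: le_trans (hM _ _ _ _ _ hw) _ => //.
    by rewrite ler_wpM2l // ltW.
  have := nrm_dist ip_inner (mean idfun ((j, B) :: s) w N x)
    (mean idfun ((j, idfun) :: s) w N y) l; lra.
(* Each [p.1] is an eigenvalue inverse to [conjc p.1], so [F0] lies in [sigma_a]; every [F]
   containing it satisfies the hypothesis of [esum_first]. *)
pose F0 := undup [seq conjc p.1 | p <- t & `[< Defs.eigenvalue U (conjc p.1) >]].
have hF0 : fin_subset_sigma_a ip U F0.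
  split; first exact: undup_uniq.
  move=> z; rewrite mem_undup => /mapP[p]; rewrite mem_filter => /andP[/asboolP pv pt ->].
  have [pv' _] := ht p pt; split=> //; exists p.1; split=> //.
  by rewrite unit_conjcM // (eigenvalue_norm ip_inner U_unitary pv').
have nF0 : finsets [set F | fin_subset_sigma_a ip U F /\ {subset F0 <= F}] by exists F0.
apply: filterS2 nF0 (hl2 _ e2) => F /= [hF F0F].
rewrite -(@esum_first F s w j t) //; first last.
- move=> p pt pv; apply: F0F; rewrite mem_undup; apply/mapP; exists p => //.
  by rewrite mem_filter pt andbT; apply/asboolP.
- by case: hF.
rewrite -/y => h.
have hd : nrm (esum F ((j, B) :: s) w x - esum F ((j, idfun) :: s) w y) <= M' * d.
  have -> : esum F ((j, B) :: s) w x = esum F ((j, idfun) :: s) w (B x) by [].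
  rewrite -(linB (lin_esum _ _ wid)) //; apply: le_trans (hM' _ _ _ hF hw) _ => //.
  by rewrite ler_wpM2l // ltW.
have := nrm_dist ip_inner (esum F ((j, B) :: s) w x) (esum F ((j, idfun) :: s) w y) l.
lra.
Qed.

End Words.

(** * Translation of [S_net] and [cesaro] into words *)

Section Chains.
Variables (R : realType) (H : lmodType R[i]) (ip : H -> H -> R[i]).
Variables (U : H -> H) (E : R[i] -> H -> H) (k : nat) (alpha : nat -> nat).
Variable (A : nat -> H -> H).
Local Notation word := (seq (nat * (H -> H))).
Implicit Types (s : word) (w : nat -> R[i]) (F : seq R[i]).

(** One summand of [S_net]: the eigenvalues of all letters are fixed in advance by [z]. *)
Fixpoint echain s (z : nat -> R[i]) x : H :=
  match s with
  | [::] => x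
  | (j, B) :: s' => echain s' z (E (if j \in unzip1 s' then conjc (z j) else z j) (B x))
  end.

Lemma pick_tupleE F (f : {ffun 'I_k -> 'I_(size F)}) (o : 'I_k) :
  pick_tuple f o = F`_(f o).
Proof. by rewrite /pick_tuple valK. Qed.

(* The letters of [s] that do not occur twice are those whose eigenvalue has
   already been fixed by [w]. *)
Lemma sum_echain F s w x : uniq F -> wf ip k s ->
  (forall j, (j < k)%N -> count_mem j (unzip1 s) != 2%N -> w j \in F) ->
  \sum_(f : {ffun 'I_k -> 'I_(size F)} |
      [forall j : 'I_k, (count_mem (j : nat) (unzip1 s) != 2%N) ==> (F`_(f j) == w j)])
    echain s (pick_tuple f) x = esum E F s w x.
Proof.
move=> uF; elim: s w x => [|[j B] s IH] w x.
  (* No letter is left, so every coordinate is fixed by [w] and one tuple remains. *)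
  move=> _ wF /=; have wF' (j : 'I_k) : (index (w j) F < size F)%N.
    by rewrite index_mem wF.
  rewrite (big_pred1 [ffun j => Ordinal (wF' j)]) // => f /=.
  apply/forallP/eqP => [h|-> j]; last by rewrite ffunE /= nth_index ?wF.
  apply/ffunP => j; rewrite ffunE; apply: val_inj => /=.
  by have /eqP <- := h j; rewrite index_uniq.
move=> /= [jk _ js1 ws] wF; pose o := Ordinal jk.
have [js|js] := boolP (j \in unzip1 s).
  have c1 : count_mem j (unzip1 s) = 1%N.
    by apply/eqP; rewrite eqn_leq js1 -has_count has_pred1.
  (* Grouping tuples by their value at [j] gives the outer sum over [F] of [esum]. *)
  rewrite (partition_big (fun f : {ffun _ -> _} => f o) predT) //=.
  rewrite (big_nth 0) big_mkord; apply: eq_bigr => m _.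
  rewrite -IH // => [|i ik ci]; last first.
    rewrite /upd; case: eqP => [_|/eqP ij]; first exact: mem_nth.
    by apply: wF => //; rewrite [j == i]eq_sym (negPf ij).
  apply: eq_big => [f|f /andP[_ /eqP fo]]; last by rewrite (pick_tupleE f o) fo.
  apply/andP/forallP => [[/forallP h /eqP fo] i|h].
    have := h i; rewrite /upd [(i : nat) == j]eq_sym.
    case: (eqVneq j i) => [ij _|//].
    by rewrite (_ : i = o) ?fo ?eqxx ?implybT //; apply: val_inj.
  split.
    apply/forallP => i; have := h i; rewrite /upd [(i : nat) == j]eq_sym.
    by case: (eqVneq j i) => [<- _|//]; rewrite c1.
  have := h o; rewrite /= c1 upd_eq /= nth_uniq //.
(* At a last occurrence the count drops from one to zero; the constraint on tuples is unchanged. *)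
have c0 : count_mem j (unzip1 s) = 0%N.
  by apply/eqP; rewrite -leqn0 leqNgt -has_count has_pred1.
rewrite -IH // => [|i ik ci]; last first.
  by apply: wF => //; case: (eqVneq j i) => [<-|//]; rewrite c0.
apply: eq_big => [f|f /forallP /(_ o)].
  apply: eq_forallb => i; case: (eqVneq j i) => // <-.
  by rewrite c0.
by rewrite /= eqxx c0 /= => /eqP; rewrite (pick_tupleE f o) => ->.
Qed.

Definition letters_of m : word := [seq (alpha i, A i) | i <- rev (iota 0 m)].

(** The rightmost factor of [chain] acts first and has no operator before it, hence [idfun]. *)
Definition word_of m : word := (alpha m, idfun) :: letters_of m.

Lemma letters_ofS m : letters_of m.+1 = (alpha m, A m) :: letters_of m.
Proof. by rewrite /letters_of -addn1 iotaD cats1 rev_rcons. Qed.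

Lemma mem_letters_of m j :
  (j \in unzip1 (letters_of m)) = has (fun i => (alpha i == j) && (i < m)%N) (iota 0 m).
Proof.
rewrite /unzip1 /letters_of -map_comp map_rev mem_rev.
apply/mapP/hasP => [[i im ->]|[i im /andP[/eqP <- _]]]; last by exists i.
by exists i => //; rewrite eqxx; move: im; rewrite mem_iota.
Qed.

Lemma zsharpE (z : nat -> R[i]) m : (m < k.*2)%N -> zsharp k alpha z m =
  if alpha m \in unzip1 (letters_of m) then conjc (z (alpha m)) else z (alpha m).
Proof.
move=> mk; rewrite /zsharp mem_letters_of; congr (if _ then _ else _).
apply/hasP/hasP => -[i _ ai]; exists i => //; have /andP[_ im] := ai.
  by rewrite mem_iota.
by rewrite mem_iota (ltn_trans im mk).
Qed.

Lemma chainE (G B : nat -> H -> H) m x :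
  chain G B m x = foldr (fun i y => G i (B i y)) (G m x) (iota 0 m).
Proof. by rewrite /chain; elim: (iota 0 m) => //= i t ->. Qed.

Lemma chain_echain (z : nat -> R[i]) m x : (m < k.*2)%N ->
  chain (fun i => E (zsharp k alpha z i)) A m x = echain (word_of m) z x.
Proof.
rewrite chainE => mk; rewrite /= -zsharpE //; set y := E _ x.
elim: m y mk => {x} [|m IH] y mk //.
rewrite letters_ofS -addn1 iotaD cats1 foldr_rcons IH ?(ltnW mk) //=.
by rewrite -zsharpE // ltnW.
Qed.

Lemma chain_uword (n : nat -> nat) w m x : (forall j, w j = 1) ->
  chain (fun i => iter (n (alpha i)) U) A m x = uword U idfun (word_of m) w n x.
Proof.
(* All weights stay equal to 1, so [uword] only composes powers of [U] with the operators. *)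
have step s B j w' y : (forall i, w' i = 1) -> exists2 w'', forall i, w'' i = 1 &
    uword U idfun ((j, B) :: s) w' n y = uword U idfun s w'' n (iter (n j) U (B y)).
  move=> w1 /=; case: ifP => _; last first.
    by exists w' => //; rewrite w1 conjc1 expr1n scale1r.
  by exists (upd w' j 1) => // i; rewrite /upd; case: eqP.
rewrite chainE => w1; have [w' w1' ->] := step (letters_of m) idfun (alpha m) w x w1.
move: {x} (iter _ U _) => x; elim: m x w' w1' {w w1} => [|m IH] x w w1 //.
rewrite letters_ofS -addn1 iotaD cats1 foldr_rcons.
by have [w' w1' ->] := step (letters_of m) (A m) (alpha m) w x w1; rewrite (IH _ w').
Qed.

Hypothesis alpha_pp : pair_partition k alpha.
Hypothesis k_gt0 : (1 <= k)%N.
Hypothesis A_bounded : forall i, (i < (k.*2).-1)%N -> bounded_op ip (A i).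

Let word_index : (k.*2).-1.+1 = k.*2.
Proof. by rewrite prednK // double_gt0. Qed.

Lemma count_letters j :
  count_mem j (unzip1 (letters_of k.*2)) = if (j < k)%N then 2%N else 0%N.
Proof.
case: alpha_pp => alpha_lt alpha2.
rewrite /unzip1 /letters_of -map_comp map_rev count_rev count_map.
case: ifP => [jk|jk]; first exact: alpha2.
apply/eqP; rewrite -leqn0 leqNgt -has_count; apply/hasP; case=> i.
by rewrite mem_iota /= => /alpha_lt ik /eqP ij; rewrite -ij ik in jk.
Qed.

Lemma unzip1_word : unzip1 (word_of (k.*2).-1) = unzip1 (letters_of k.*2).
Proof. by rewrite -[in RHS]word_index letters_ofS. Qed.

(** Each tail is some [letters_of m], part of a list containing every letter below [k] twice;
    discounting position [m] itself leaves at most one [alpha m]. *)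
Lemma wf_word : wf ip k (word_of (k.*2).-1).
Proof.
case: (alpha_pp) => alpha_lt _.
have count_le2 m j : (m <= k.*2)%N -> (count_mem j (unzip1 (letters_of m)) <= 2)%N.
  move=> mk; apply: leq_trans (_ : (count_mem j (unzip1 (letters_of k.*2)) <= 2)%N).
    rewrite -(subnKC mk); elim: (_ - _)%N => [|d IH]; first by rewrite addn0.
    by rewrite addnS letters_ofS (leq_trans IH) ?leq_addl.
  by rewrite count_letters; case: ifP.
have count_le1 m : (m < k.*2)%N ->
    (count_mem (alpha m) (unzip1 (letters_of m)) <= 1)%N.
  by move=> /(@count_le2 m.+1 (alpha m)); rewrite letters_ofS /= eqxx.
have last_lt : ((k.*2).-1 < k.*2)%N by rewrite word_index.
split; [exact: alpha_lt|exact: id_bounded|exact: count_le1|].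
have : ((k.*2).-1 <= (k.*2).-1)%N by [].
elim: {1 3}(_.-1) => [|m IH] mk //; rewrite letters_ofS.
have mk' : (m < k.*2)%N by apply: leq_ltn_trans last_lt; apply: ltnW.
by split; [exact: alpha_lt|exact: A_bounded|exact: count_le1|exact/IH/ltnW].
Qed.

(** Every letter occurs twice, so no tuple is excluded and [w] is arbitrary. *)
Lemma S_net_esum F w x : uniq F ->
  S_net E k alpha A F x = esum E F (word_of (k.*2).-1) w x.
Proof.
move=> uF; have last_lt : ((k.*2).-1 < k.*2)%N by rewrite word_index.
have c2 j : (j < k)%N -> count_mem j (unzip1 (word_of (k.*2).-1)) = 2%N.
  by move=> jk; rewrite unzip1_word count_letters jk.
rewrite -(sum_echain _ uF wf_word) => [|j jk]; last by rewrite c2.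
apply: eq_big => [f|f _]; last exact: chain_echain.
by symmetry; apply/forallP => j; rewrite c2.
Qed.

Lemma cesaro_mean N w x : (forall j, w j = 1) ->
  cesaro U k alpha A N x = mean U k idfun (word_of (k.*2).-1) w N x.
Proof.
move=> w1; rewrite /cesaro /mean /avg; congr (_ *: _).
by apply: eq_bigr => n _; apply: (chain_uword (env n) _ _ w1).
Qed.

End Chains.

(** * Uniqueness of the weak limit, and the theorem *)

Lemma is_S_unique (R : realType) (H : lmodType R[i]) (ip : H -> H -> R[i])
    (U : H -> H) (E : R[i] -> H -> H) (k : nat) (alpha : nat -> nat)
    (A : nat -> H -> H) (S S' : H -> H) : is_inner_product ip ->
  is_S ip U E k alpha A S -> is_S ip U E k alpha A S' -> S =1 S'.
Proof.
move=> ip_inner hS hS' x; apply: (ip_inj ip_inner) => y.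
apply/eqP; rewrite -subr_eq0 -normr_le0 -[X in X <= _]RRe_real ?ger0_real //.
rewrite lecR; apply/ler_addgt0Pl => e e0; rewrite addr0 -lecR RRe_real ?ger0_real //.
have e2 : 0 < e / 2 by lra.
have [F [hF {}hS]] := hS x y _ e2; have [G [hG {}hS']] := hS' x y _ e2.
(* The union lies beyond both thresholds. *)
have hFG := finset_cup hF hG.
have /ltW h1 := hS _ hFG (fun z zF => ltac:(by rewrite mem_undup mem_cat zF)).
have /ltW h2 := hS' _ hFG (fun z zG => ltac:(by rewrite mem_undup mem_cat zG orbT)).
rewrite [e]splitr rmorphD; apply: le_trans (lerD h1 h2).
rewrite [X in _ <= X + _]distrC; apply: le_trans (ler_normD _ _).
by rewrite addrA subrK.
Qed.

Theorem theorem3p1 (R : realType) (H : lmodType R[i]) (ip : H -> H -> R[i])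
    (U : H -> H) (E : R[i] -> H -> H) (k : nat) (alpha : nat -> nat)
    (A : nat -> H -> H) :
  is_hilbert ip -> unitary ip U -> almost_periodic ip U ->
  eigenprojections ip U E ->
  (1 <= k)%N -> pair_partition k alpha ->
  (forall i : nat, (i < (k.*2).-1)%N -> bounded_op ip (A i)) ->
  (exists S : H -> H, bounded_op ip S /\ is_S ip U E k alpha A S) /\
  (forall S : H -> H, is_S ip U E k alpha A S ->
     forall x : H, seq_converges ip (fun N => cesaro U k alpha A N x) (S x)).
Proof.
move=> hilb hU ap hE k0 pp hA; have ip_inner : is_inner_product ip by case: hilb.
pose w (_ : nat) : R[i] := 1; pose s := word_of alpha A (k.*2).-1.
have w1 j : `|w j| = 1 by rewrite normr1.
have ws : wf ip k s := wf_word pp k0 hA.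
(* The limits exist vector by vector; choice assembles them into a map. *)
have [S hS] := choice (fun x => mean_esum_conv hilb hU ap hE x ws w1).
have cesS x : conv ip \oo%classic (fun N => cesaro U k alpha A N x) (S x).
  have [+ _] := hS x; apply: conv_eq => N.
  exact: cesaro_mean.
have isS : is_S ip U E k alpha A S.
  move=> x y e e0; have [_ hx] := hS x.
  (* Cauchy-Schwarz turns norm convergence into weak convergence; the [+ 1] covers [y = 0]. *)
  have d0 : 0 < e / (nrm ip y + 1).
    by apply: divr_gt0 => //; have := nrm_ge0 ip_inner y; lra.
  have [F0 hF0 hF] := hx _ d0; exists F0; split=> // F hFF F0F.
  have /= hSF := hF F (conj hFF F0F).
  rewrite (S_net_esum E pp k0 hA w x) -?(ipBl ip_inner); last by case: hFF.
  set v := _ - S x; rewrite -[X in X < _]RRe_real ?ger0_real // ltcR.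
  apply: le_lt_trans (cauchy_schwarz ip_inner v y) _.
  have := nrm_ge0 ip_inner y; move: hSF; rewrite ltr_pdivlMr; last first.
    by have := nrm_ge0 ip_inner y; lra.
  have := nrm_ge0 ip_inner v; rewrite -/v mulrDr mulr1; lra.
split; last first.
  move=> S' isS' x; rewrite -(is_S_unique ip_inner isS isS' x).
  exact/(seq_convergesE ip_inner).
exists S; split=> //; split.
  move=> a x y; have [h _] := hS (a *: x + y); have [hx _] := hS x; have [hy _] := hS y.
  apply: (conv_unique ip_inner h).
  apply: conv_eq (convD ip_inner (convZ ip_inner a hx) hy) => N.
  exact: (lin_mean hU).
(* The bound on the means does not depend on [N], so it passes to the limit. *)
have [M M0 hM] := mean_bound hilb hU ws; exists M => x.
rewrite !(hnormE ip_inner) -rmorphM lecR -[S x]subr0.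
have [hx _] := hS x; apply: (conv_nrm_le ip_inner hx).
by apply: filterS filterT => N _ /=; rewrite subr0 hM.
Qed.
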